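(* Let $G$ be a $2$-connected finitely separable graph, let $X\subseteq E(G)$ and $Y:=E(G)\setminus X$. Then: (i) $\kappa_{M_{\rm FC}(G)}(X)=\infty$ if and only if $|V[X]\cap V[Y]|=\infty$; and (ii) if $\kappa_{M_{\rm FC}(G)}(X)<\infty$ then $\kappa_{M_{\rm FC}(G)}(X)=|V[X]\cap V[Y]|-c(X)-c(Y)+1$.
   Context: Graphs may be infinite. A graph is finitely separable if any two vertices can be separated by deleting finitely many edges. For $X\subseteq E(G)$, $V[X]$ denotes the set of vertices incident with an edge of $X$, and $c(X)$ denotes the number of components of the subgraph $(V[X],X)$. Matroids may be infinite: a matroid on $E$ is given by a family $\mathcal I\subseteq 2^E$ of independent sets satisfying (I1) $\emptyset\in\mathcal I$; (I2) closure under subsets; (I3) for every non-maximal $I\in\mathcal I$ and maximal $I'\in\mathcal I$ there is $x\in I'\setminus I$ with $I\cup\{x\}\in\mathcal I$; (IM) whenever $I\subseteq X\subseteq E$ and $I\in\mathcal I$, the set $\{I'\in\mathcal I: I\subseteq I'\subseteq X\}$ has a maximal element. Bases are maximal independent sets; $M|X$ is the restriction and $M\setminus X=M|(E\setminus X)$. Connectivity function: for $X\subseteq E$ choose a basis $B$ of $M|X$, a basis $B'$ of $M\setminus X$, and $F\subseteq B\cup B'$ with $(B\cup B')\setminus F$ a basis of $M$; set $\kappa_M(X):=|F|\in\mathbb N\cup\{\infty\}$ (infinite cardinalities identified); this is independent of the choices. The finite-cycle matroid $M_{\rm FC}(G)$ is the matroid on $E(G)$ whose independent sets are the edge sets not containing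 the edge set of any finite cycle of $G$. *)

(* Defs.v *)
From HB Require Import structures.
From Stdlib Require Import Relation_Operators Operators_Properties.
From mathcomp Require Import all_boot all_order all_algebra.
From mathcomp Require Import boolp classical_sets functions cardinality.
From mathcomp Require Import constructive_ereal.

Set Implicit Arguments.
Unset Strict Implicit.
Unset Printing Implicit Defensive.

Import Order.TTheory GRing.Theory Num.Theory.

Local Open Scope classical_set_scope.

(* The cardinality of a set, with all infinite cardinalities identified. The
   extended integers allow cardinalities to be subtracted; there, a sum having
   an infinite term is infinite. *)
Definition ecard (T : Type) (A : set T) : \bar int :=
  if pselect (finite_set A) is left finA
  then ((projT1 (cid finA))%:Z)%:E%E else +oo%E.

Lemma ecard_fin (T : Type) (A : set T) (n : nat) :
  ecard A = (n%:Z)%:E%E <-> (A #= `I_n)%card.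
Proof.
rewrite /ecard; case: pselect => [finA|infA]; last first.
  by split=> // An; case: infA; exists n.
case: (cid finA) => m /= Am; split=> [[<-//]|An].
have : (`I_m #= `I_n)%card by apply: card_eq_trans An; rewrite card_eq_sym.
by move=> /card_eq_II ->.
Qed.

Lemma ecard_pinfty (T : Type) (A : set T) :
  ecard A = +oo%E <-> infinite_set A.
Proof. by rewrite /ecard; case: pselect => [finA|infA]; split=> // /(_ finA). Qed.

Section Matroid.
Context {E : Type}.
Implicit Types (F : set (set E)) (A I J X : set E).

Definition maximal_in F A := F A /\ forall J, F J -> A `<=` J -> J = A.

Record matroid := Matroid {
  indep : set (set E);
  indep0 : indep set0;
  indep_sub : forall I J, indep I -> J `<=` I -> indep J;
  indep_aug : forall I I', indep I -> ~ maximal_in indep I ->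
    maximal_in indep I' -> exists2 x, (I' `\` I) x & indep (I `|` [set x]);
  indep_max : forall I X, indep I -> I `<=` X -> exists J,
    maximal_in [set I' | [/\ indep I', I `<=` I' & I' `<=` X]] J }.

Definition basis (M : matroid) : set (set E) := maximal_in (indep M).

Definition restr_indep (M : matroid) X : set (set E) :=
  [set J | indep M J /\ J `<=` X].

Definition restr_basis (M : matroid) X : set (set E) :=
  maximal_in (restr_indep M X).

Definition is_connectivity (M : matroid) X (k : \bar int) : Prop :=
  exists B B' A, [/\ restr_basis M X B, restr_basis M (~` X) B',
    A `<=` B `|` B', basis M ((B `|` B') `\` A) & k = ecard A].

Lemma restr_basis_ex (M : matroid) X : exists B, restr_basis M X B.
Proof.
have [B [[iB _ BX] Bmax]] := indep_max (indep0 M) (@sub0set _ X).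
exists B; split=> // J [iJ JX] BJ; apply: Bmax => //.
by split=> //; exact: sub0set.
Qed.

Lemma is_connectivity_ex (M : matroid) X : exists k, is_connectivity M X k.
Proof.
have [B [[iB BX] Bmax]] := restr_basis_ex M X.
have [B' [[iB' B'X] B'max]] := restr_basis_ex M (~` X).
have [J [[iJ BJ JBB] Jmax]] := indep_max iB (@subsetUl _ B B').
have [D [[iD B'D _] Dmax]] := indep_max iB' (@subsetT _ B').
have bD : maximal_in (indep M) D.
  split=> // K iK DK; apply: Dmax => //; split=> //; exact: subset_trans DK.
have bJ : basis M J.
  apply: contrapT => nJ.
  have [x [Dx Jx] iJx] := indep_aug iJ nJ bD.
  have BB'x : (B `|` B') x.
    have [Xx|Xx] := pselect (X x).
      left; have <- : B `|` [set x] = B; last by right.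
      apply: Bmax; last exact: subsetUl.
      split; first by apply: indep_sub iJx _; exact: setSU.
      by move=> y [/BX//|->].
    right; have <- : D `&` ~` X = B'; last by [].
    apply: B'max; last by move=> y B'y; split; [exact: B'D|exact: B'X].
    split; last by move=> y [].
    by apply: indep_sub iD _ => y [].
  apply: Jx; have <- : J `|` [set x] = J; last by right.
  apply: Jmax; last exact: subsetUl.
  split=> //; first by apply: subset_trans BJ _; exact: subsetUl.
  by move=> y [/JBB//|->].
exists (ecard ((B `|` B') `\` J)), B, B', ((B `|` B') `\` J); split=> //.
by rewrite setDD; have /setIidPr -> := JBB.
Qed.

(* The value does not depend on B, B' and A, so any choice of them will do. *)
Definition connectivity (M : matroid) X : \bar int :=
  projT1 (cid (is_connectivity_ex M X)).

End Matroid.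
Arguments matroid : clear implicits.

(* Arbitrary cardinality, parallel edges allowed, loops excluded. *)
Record graph := Graph {
  vertex : Type;
  edge : Type;
  ends : edge -> set vertex;
  endsP : forall e, exists u v, u <> v /\ ends e = [set u; v] }.

Section Graph.
Context {G : graph}.
Implicit Types (A C X : set (edge G)) (W S : set (vertex G)).
Implicit Types (u v : vertex G) (e : edge G).

Definition joins e u v : Prop := ends e = [set u; v].

(* There is a (finite) walk from u to v with all edges in A. *)
Definition linked A : vertex G -> vertex G -> Prop :=
  clos_refl_trans _ (fun u v => exists2 e, A e & joins e u v).

(* In the next two definitions (W, A) is a subgraph of G, so the edges of A
   are meant to have their ends in W. A component is given by its vertex set. *)
Definition connected W A : Prop :=
  W !=set0 /\ forall u v, W u -> W v -> linked A u v.

Definition components W A : set (set (vertex G)) :=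
  [set linked A u | u in W].

Definition incident_vertices X : set (vertex G) :=
  \bigcup_(e in X) ends e.

Definition ncomp X : \bar int := ecard (components (incident_vertices X) X).

(* The vertices v 0, ..., v (n-1) and the edges e 0, ..., e (n-1) of a cycle of
   length n, in cyclic order. As there are no loops, n >= 2. *)
Definition finite_cycle C : Prop :=
  exists (n : nat) (v : nat -> vertex G) (e : nat -> edge G),
    [/\ (0 < n)%N, set_inj `I_n v, set_inj `I_n e,
        (forall i, (i < n)%N -> joins (e i) (v i) (v (i.+1 %% n)%N))
      & C = e @` `I_n].

Definition acyclic A : Prop := forall C, finite_cycle C -> ~ C `<=` A.

Lemma linked_sym A u v : linked A u v -> linked A v u.
Proof.
elim=> [x y [e Ae exy]|x|x y z _ IH1 _ IH2]; last exact: rt_trans IH2 IH1.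
  by apply: rt_step; exists e => //; rewrite /joins exy setUC.
exact: rt_refl.
Qed.

Lemma linkedS A A' u v : A `<=` A' -> linked A u v -> linked A' u v.
Proof.
move=> AA'; elim=> [x y [e Ae exy]|x|x y z _ IH1 _ IH2].
- by apply: rt_step; exists e => //; exact: AA'.
- exact: rt_refl.
- exact: rt_trans IH1 IH2.
Qed.

Lemma joins_neq e u v : joins e u v -> u <> v.
Proof.
move=> euv uv; have [x [y [xy exy]]] := endsP e; apply: xy.
have : [set x; y] x by left.
have : [set x; y] y by right.
by rewrite -exy euv uv => -[->|->] [->|->].
Qed.

Lemma joins_inj e u v x y : joins e u v -> joins e x y ->
  (u = x /\ v = y) \/ (u = y /\ v = x).
Proof.
move=> euv exy; have uv := joins_neq euv.
have Hu : [set x; y] u by rewrite -exy euv; left.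
have Hv : [set x; y] v by rewrite -exy euv; right.
by move: Hu Hv uv => [->|->] [->|->]; [|left|right|].
Qed.

Lemma linked_range A n (v : nat -> vertex G) (e : nat -> edge G) (i j : nat) :
  (forall k, (i <= k < j)%N -> A (e k)) ->
  (forall k, (i <= k < j)%N -> joins (e k) (v k) (v k.+1)) ->
  (i <= j <= n)%N -> linked A (v i) (v j).
Proof.
elim: j => [|j IH] Ae ev.
  by rewrite leqn0 => /andP[/eqP -> _]; exact: rt_refl.
rewrite leq_eqVlt => /andP[/orP[/eqP <- _|ij jn]]; first exact: rt_refl.
apply: (@rt_trans _ _ _ (v j)).
  apply: IH => [k /andP[ik kj]|k /andP[ik kj]|].
  - by apply: Ae; rewrite ik ltnW.
  - by apply: ev; rewrite ik ltnW.
  - by rewrite -ltnS ij ltnW.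
apply: rt_step; exists (e j); first by apply: Ae; rewrite -ltnS ij ltnSn.
by apply: ev; rewrite -ltnS ij ltnSn.
Qed.

Lemma cyclic_linked A e u v : joins e u v -> acyclic A ->
  ~ acyclic (A `|` [set e]) -> linked A u v.
Proof.
move=> euv aA /existsNP[C] /not_implyP[cC /contrapT CA].
have Ce : C e.
  apply: contrapT => nCe; apply: (aA _ cC) => x Cx.
  by case: (CA _ Cx) => // xe; case: nCe; rewrite -xe.
case: (cC) => n [p [q [n0 pinj qinj qj Cq]]].
move: (Ce); rewrite Cq => -[i /= ilt qi].
have Aq k : (k < n)%N -> k <> i -> A (q k).
  move=> kn ki; have : C (q k) by rewrite Cq; exists k.
  move=> /CA[//|]; rewrite /= -qi => qki; case: ki.
  by apply: qinj => //; rewrite inE.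
have l1 : linked A (p 0%N) (p i).
  apply: (@linked_range A n p q) => [k /andP[_ ki]|k /andP[_ ki]|].
  - apply: Aq; first exact: ltn_trans ki ilt.
    by move=> E; move: ki; rewrite E ltnn.
  - have kn : (k.+1 < n)%N by exact: leq_ltn_trans ki ilt.
    by have := qj _ (ltnW kn); rewrite modn_small.
  - by rewrite /= ltnW.
have l2 : linked A (p (i.+1 %% n)%N) (p 0%N).
  have [->|iSn] := eqVneq i.+1 n; first by rewrite modnn; exact: rt_refl.
  have {}iSn : (i.+1 < n)%N by rewrite ltn_neqAle iSn.
  rewrite modn_small //; apply: (@rt_trans _ _ _ (p n.-1)).
    apply: (@linked_range A n p q) => [k /andP[ik ki]|k /andP[ik ki]|].
    - apply: Aq; first exact: leq_trans ki (leq_pred _).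
      by move=> E; move: ik; rewrite E ltnn.
    - have kn : (k.+1 < n)%N by rewrite -[n]prednK// ltnS.
      by have := qj _ (ltnW kn); rewrite modn_small.
    - by rewrite leq_pred -ltnS prednK// iSn.
  apply: rt_step; exists (q n.-1).
    apply: Aq; first by rewrite prednK.
    by move=> E; move: iSn; rewrite -E prednK// ltnn.
  have := qj n.-1; rewrite prednK// modnn; apply; exact: leqnn.
have l : linked A (p (i.+1 %% n)%N) (p i) by exact: rt_trans l2 l1.
have := qj i ilt; rewrite qi => /(joins_inj euv)[[-> ->]|[-> ->]] //.
exact: linked_sym.
Qed.

Definition walk A u v n (p : nat -> vertex G) (q : nat -> edge G) :=
  [/\ p 0%N = u, p n = v, forall k, (k < n)%N -> A (q k)
    & forall k, (k < n)%N -> joins (q k) (p k) (p k.+1)].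

Lemma linked_walk A u v (e0 : edge G) :
  linked A u v -> exists n p q, walk A u v n p q.
Proof.
move=> luv; have {luv} := clos_rt_rt1n _ _ _ _ luv.
elim=> [x|x y z [e Ae exy] _ [n [p [q [p0 pn Aq jq]]]]].
  by exists 0%N, (fun=> x), (fun=> e0).
exists n.+1, (fun k => if k is k'.+1 then p k' else x),
  (fun k => if k is k'.+1 then q k' else e).
split=> // -[|k] //; [exact: Aq|by rewrite /= p0|exact: jq].
Qed.

Lemma linked_cyclic A e u v : joins e u v -> ~ A e -> linked A u v ->
  ~ acyclic (A `|` [set e]).
Proof.
move=> euv nAe /(linked_walk e) ex.
have exb : exists n, `[< exists p q, walk A u v n p q >].
  by case: ex => n ?; exists n; apply/asboolP.
case: (ex_minnP exb) => n /asboolP[p [q [p0 pn Aq jq]]] nmin.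
have pneq i j : (i < j)%N -> (j <= n)%N -> p i <> p j.
  move=> ij jn pij.
  suff /nmin : `[< exists p q, walk A u v (n - (j - i)) p q >].
    by rewrite leqNgt ltn_subrL subn_gt0 ij (leq_trans _ jn)// (leq_ltn_trans _ ij).
  apply/asboolP; exists (fun k => if (k <= i)%N then p k else p (k + (j - i))%N).
  exists (fun k => if (k < i)%N then q k else q (k + (j - i))%N).
  have lt k : (k < n - (j - i))%N -> (k + (j - i) < n)%N by rewrite ltn_subRL addnC.
  split=> [||k kn|k kn].
  - by rewrite leq0n.
  - have dn : (j - i <= n)%N by exact: leq_trans (leq_subr _ _) jn.
    rewrite subnK//; case: leqP => // H; rewrite -pn.
    have -> : n = j.
      apply/eqP; rewrite eqn_leq jn andbT.
      by move: H; rewrite leq_subLR subnK // ltnW.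
    rewrite -pij; congr p; rewrite subKn//; exact: ltnW.
  - case: ltnP => _; last by apply: Aq; exact: lt.
    by apply: Aq; apply: leq_trans kn (leq_subr _ _).
  - case: (ltngtP k i) => ki.
    + by apply: jq; apply: leq_trans kn (leq_subr _ _).
    + by apply: jq; exact: lt.
    + rewrite ki pij; have := jq _ (lt _ kn).
      by rewrite ki addSn subnKC// ltnW.
have pinj : set_inj `I_n.+1 p.
  move=> i j; rewrite !inE /= !ltnS => ilt jlt pij.
  by case: (ltngtP i j) => // /pneq H; [have := H jlt|have := H ilt]; rewrite pij.
pose c k := if (k < n)%N then q k else e.
move=> /(_ (c @` `I_n.+1)); apply.
  exists n.+1, p, c; split=> //.
    move=> i j; rewrite !inE /= !ltnS /c leq_eqVlt (leq_eqVlt j).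
    case: (ltnP i n) => [ilt _|_ /orP[/eqP ->|//]];
      case: (ltnP j n) => [jlt _|_ /orP[/eqP ->|//]] => //.
    + have inp k : (k <= n)%N -> k \in `I_n.+1 by rewrite inE /= ltnS.
      move=> qij; have := jq _ ilt; rewrite qij => /(joins_inj (jq _ jlt)).
      move=> [[E _]|[E1 E2]]; first by apply/esym/pinj => //; apply: inp; exact: ltnW.
      have {}E1 : j = i.+1 by apply: pinj => //; apply: inp => //; exact: ltnW.
      have {}E2 : j.+1 = i by apply: pinj => //; apply: inp => //; exact: ltnW.
      by move: E2; rewrite E1 => /eqP; rewrite -addn2 -{2}[i]addn0 eqn_add2l.
    + by move=> qe; case: nAe; rewrite -qe; exact: Aq.
    + by move=> qe; case: nAe; rewrite qe; exact: Aq.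
  move=> i; rewrite ltnS leq_eqVlt /c => /orP[/eqP ->|ilt].
    by rewrite ltnn modnn pn p0 /joins setUC.
  by rewrite ilt modn_small ?ltnS//; exact: jq.
move=> _ [k /= _ <-]; rewrite /c; case: ifP => kn; last by right.
by left; exact: Aq.
Qed.

Lemma acyclic0 : acyclic set0.
Proof.
move=> C [n [v [e [n0 _ _ _ ->]]]] /(_ (e 0%N)).
by apply; exists 0%N.
Qed.

Lemma acyclic_sub A A' : acyclic A -> A' `<=` A -> acyclic A'.
Proof. by move=> aA A'A C /aA nC CA'; apply: nC; exact: subset_trans A'A. Qed.

Lemma acyclic_aug A A' : acyclic A -> ~ maximal_in acyclic A ->
  maximal_in acyclic A' ->
  exists2 x, (A' `\` A) x & acyclic (A `|` [set x]).
Proof.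
move=> aA nmA [aA' mA'].
have {nmA} [J [aJ AJ [e [Je nAe]]]] :
    exists J, [/\ acyclic J, A `<=` J & exists e, J e /\ ~ A e].
  apply: contrapT => H; apply: nmA; split=> // J aJ AJ; apply/seteqP; split=> //.
  move=> e Je; apply: contrapT => nAe; apply: H; exists J; split=> //.
  by exists e.
have [u [v [uv euv]]] := endsP e.
have nl : ~ linked A u v.
  move=> /(linked_cyclic euv nAe); apply; apply: acyclic_sub aJ _.
  by move=> x [/AJ//|->].
have lA' : linked A' u v.
  have [A'e|nA'e] := pselect (A' e); first by apply: rt_step; exists e.
  apply: (cyclic_linked euv aA') => aA'e; apply: nA'e.
  by rewrite -(mA' _ aA'e (@subsetUl _ _ _)); right.
have [x A'x [y [z [xyz nyz]]]] : exists2 x, A' x &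
    exists y z, joins x y z /\ ~ linked A y z.
  apply: contrapT => H; apply: nl.
  elim: lA' => [y z [x A'x xyz]|y|y z t _ IH1 _ IH2]; last exact: rt_trans IH1 IH2.
    by apply: contrapT => nyz; apply: H; exists x => //; exists y, z.
  exact: rt_refl.
exists x.
  by split=> // Ax; apply: nyz; apply: rt_step; exists x.
by apply: contrapT => nax; apply: nyz; exact: cyclic_linked nax.
Qed.

Lemma acyclic_max A X : acyclic A -> A `<=` X -> exists J,
  maximal_in [set A' | [/\ acyclic A', A `<=` A' & A' `<=` X]] J.
Proof.
move=> aA AX; pose P := [set B | acyclic (A `|` B) /\ B `<=` X].
have [F FP Ftot|B [[aB BX] Bmax]] := @Zorn_bigcup _ P.
  split; last by move=> x [B /FP[_ BX]] /BX.
  move=> C cC CF; have [n [v [e [n0 _ _ _ Ce]]]] := cC.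
  have [[B FB]|F0] := pselect (exists B, F B); last first.
    apply: (aA _ cC) => x /CF[//|[B FB _]].
    by case: F0; exists B.
  have [D FD CD] : exists2 D, F D & forall k, (k < n)%N -> (A `|` D) (e k).
    have {n0 Ce} : forall k, (k < n)%N -> (A `|` \bigcup_(B in F) B) (e k).
      by move=> k kn; apply: CF; rewrite Ce; exists k.
    elim: n => [|n IH] H; first by exists B.
    have [k kn|D FD DH] := IH; first by apply: H; exact: ltnW.
    have [Ae|[D' FD' D'e]] := H n (ltnSn n).
      exists D => // k; rewrite ltnS leq_eqVlt => /orP[/eqP ->|/DH//]; by left.
    have [DD'|D'D] := Ftot _ _ FD FD'.
      exists D' => // k; rewrite ltnS leq_eqVlt => /orP[/eqP ->|/DH[]].
      + by right.
      + by left.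
      + by move=> /DD'; right.
    exists D => // k; rewrite ltnS leq_eqVlt => /orP[/eqP ->|/DH//].
    by right; exact: D'D.
  have [aD _] := FP _ FD; apply: (aD _ cC).
  by rewrite Ce => _ [k /= kn <-]; exact: CD.
exists (A `|` B); split.
  by split=> // x [/AX|/BX].
move=> J [aJ AJ JX] ABJ; apply: contrapT => nJ; apply: (Bmax J).
  split; first by move=> x Bx; apply: ABJ; right.
  by move=> JB; apply: nJ; apply/seteqP; split=> // x /JB; right.
by split=> //; have /setUidPr -> := AJ.
Qed.

End Graph.
Arguments vertex : clear implicits.
Arguments edge : clear implicits.

Definition finite_cycle_matroid (G : graph) : matroid (edge G) :=
  Matroid (@acyclic0 G) (@acyclic_sub G) (@acyclic_aug G) (@acyclic_max G).

(* More than k vertices, and G - S is connected for all S with |S| < k. *)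
Definition k_connected (k : nat) (G : graph) : Prop :=
  ((k%:Z)%:E < ecard [set: vertex G])%E /\
  forall S : set (vertex G), (ecard S < (k%:Z)%:E)%E ->
    connected (~` S) [set e | ends e `<=` ~` S].

Definition finitely_separable (G : graph) : Prop :=
  forall u v : vertex G, u <> v ->
    exists2 F : set (edge G), finite_set F & ~ linked (~` F) u v.

(* Main.v *)
(* Split each vertex into an X-copy carrying its X-edges and a Y-copy carrying
   its Y-edges, and join the two copies of each vertex in U = V[X] & V[Y] by a
   new edge. A spanning tree T of G becomes a spanning tree of the split graph,
   and deleting the |U| new edges leaves 1 + |U| components. If T arises from
   B | B' by deleting A, these are also the components of the forest
   (B | B') \ A of the split graph, where B | B' has c(X) + c(Y) components, so
   1 + |U| = c(X) + c(Y) + |A|. If A is finite then so is U: as G - w is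
   connected for each w in U, the tree path between the ends of some edge of A
   uses the new edge at w, and finitely many finite paths use finitely many
   edges. *)

Require Import Defs.
From Stdlib Require Import Relation_Operators Operators_Properties.
From mathcomp Require Import all_boot all_order all_algebra.
From mathcomp Require Import boolp classical_sets functions cardinality.
From mathcomp Require Import constructive_ereal.
From mathcomp Require Import zify.

Local Open Scope classical_set_scope.
Local Open Scope ereal_scope.

(** * Arithmetic of finite cardinalities *)

Section Counting.
Set Implicit Arguments.
Unset Strict Implicit.

Lemma card_setD1 {T : Type} (A : set T) (x : T) (n : nat) :
  A x -> (A `\ x #= `I_n)%card <-> (A #= `I_n.+1)%card.
Proof.
move=> Ax; split=> [An|An]; first by apply/eq_cardSP; exists x.
have [m Am] : finite_set (A `\ x).
  by apply: sub_finite_set (@subDsetl _ A [set x]) _; exists n.+1.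
have AmS : (A #= `I_m.+1)%card by apply/eq_cardSP; exists x.
have : (`I_n.+1 #= `I_m.+1)%card by rewrite -(card_eql An).
by move=> /card_eq_II [->].
Qed.

Lemma card_disjoint_setU {T : Type} (A B : set T) (a b : nat) :
  A `&` B = set0 -> (A #= `I_a)%card -> (B #= `I_b)%card ->
  (A `|` B #= `I_(a + b))%card.
Proof.
elim: a A => [|a IH] A AB Aa Bb.
  by move: Aa; rewrite II0 card_eq0 => /eqP ->; rewrite set0U.
have [x Ax Axa] := @eq_cardSP _ _ _ Aa.
rewrite addSn; apply/(card_setD1 _ (x := x)); first by left.
have -> : (A `|` B) `\ x = (A `\ x) `|` B.
  rewrite setDUl [B `\ x]not_setD1//.
  by move=> Bx; have : (A `&` B) x by []; rewrite AB.
apply: IH => //; rewrite -subset0 => y [[Ay _] By].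
by rewrite -AB.
Qed.

End Counting.

(** * Linkage, forests, and component counts under edge deletion *)

Section Graph.
Set Implicit Arguments.
Unset Strict Implicit.

Context {G : graph}.
Implicit Types (A B D F : set (edge G)) (W : set (vertex G)).
Implicit Types (u v x y : vertex G) (e : edge G).

Lemma joins_sym e u v : joins e u v -> joins e v u.
Proof. by rewrite /joins setUC. Qed.

Lemma linked_refl A u : linked A u u.
Proof. exact: rt_refl. Qed.

Lemma linked_trans A v u x : linked A u v -> linked A v x -> linked A u x.
Proof. exact: rt_trans. Qed.

Lemma linked_edge A e u v : A e -> joins e u v -> linked A u v.
Proof. by move=> Ae euv; apply: rt_step; exists e. Qed.

Lemma linked_of_edges A B u v :
  (forall e x y, A e -> joins e x y -> linked B x y) ->
  linked A u v -> linked B u v.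
Proof.
move=> AB; elim=> [x y [e Ae exy]|x|x y z _ IH1 _ IH2].
- exact: AB exy.
- exact: linked_refl.
- exact: linked_trans IH1 IH2.
Qed.

Lemma linked_eq A u v : linked A u v -> linked A u = linked A v.
Proof.
move=> uv; apply/seteqP; split=> x; first exact: linked_trans (linked_sym uv).
exact: linked_trans.
Qed.

Lemma linked_finite A u v : linked A u v ->
  exists F, [/\ finite_set F, F `<=` A & linked F u v].
Proof.
elim=> [x y [e Ae exy]|x|x y z _ [F1 [f1 s1 l1]] _ [F2 [f2 s2 l2]]].
- exists [set e]; split; [exact: finite_set1|by move=> _ ->|].
  exact: linked_edge exy.
- by exists set0; split; [exact: finite_set0|exact: sub0set|exact: linked_refl].
- exists (F1 `|` F2); split; first by rewrite finite_setU.
    by rewrite subUset.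
  apply: linked_trans (linkedS _ l1) (linkedS _ l2).
    exact: subsetUl.
  exact: subsetUr.
Qed.

(** One crossing of [e] suffices: along the walk, a further crossing either leads back to an end
    already reached within [A] or can replace the earlier one. *)
Lemma linked_setU1 A e u v x y : joins e u v -> linked (A `|` [set e]) x y ->
  [\/ linked A x y, linked A x u /\ linked A v y |
      linked A x v /\ linked A u y].
Proof.
move=> euv l; have {l} := clos_rt_rtn1 _ _ _ _ l; elim=> [|z t [f Af fzt] _ IH].
  by constructor 1; exact: linked_refl.
have [nfe|fe] := Af.
  have zt := linked_edge nfe fzt.
  case: IH => [?|[? ?]|[? ?]]; [constructor 1|constructor 2|constructor 3];
    try split=> //; exact: linked_trans zt.
rewrite fe in fzt.
have [[uz vt]|[ut vz]] := joins_inj euv fzt; subst.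
- case: IH => [xz|[xz _]|[xt _]].
  + by constructor 2; split=> //; exact: linked_refl.
  + by constructor 2; split=> //; exact: linked_refl.
  + by constructor 1.
- case: IH => [xz|[xt _]|[xz _]].
  + by constructor 3; split=> //; exact: linked_refl.
  + by constructor 1.
  + by constructor 3; split=> //; exact: linked_refl.
Qed.

(** Acyclicity in the form that every edge is a bridge. Being stated through [linked], it transfers
    between graphs by mapping walks, without tracking cycles. *)
Definition forest A :=
  forall e u v, A e -> joins e u v -> ~ linked (A `\ e) u v.

Lemma acyclic_forest A : acyclic A -> forest A.
Proof.
move=> aA e u v Ae euv l; apply: (linked_cyclic euv _ l); first by case=> _; apply.
by rewrite setUC setD1K.
Qed.

Lemma forestS A B : B `<=` A -> forest A -> forest B.
Proof.
move=> BA fA e u v Be euv l; apply: (fA e u v (BA _ Be) euv).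
by apply: linkedS l; exact: setSD.
Qed.

(** By maximality an edge of [X] outside [B] closes a cycle with [B], so its ends are already linked
    in [B]. *)
Lemma linked_maximal_acyclic X B u v : maximal_in [set J | acyclic J /\ J `<=` X] B ->
  linked B u v <-> linked X u v.
Proof.
move=> [[aB BX] Bmax]; split; first exact: linkedS.
apply: linked_of_edges => e x y Xe exy.
have [Be|nBe] := pselect (B e); first exact: linked_edge exy.
apply: (cyclic_linked exy aB) => aBe; apply: nBe.
rewrite -(Bmax (B `|` [set e])); [by right| |exact: subsetUl].
by split=> // z [/BX|->].
Qed.

(** Sending each component of the smaller forest to the component of [F] containing it merges only
    the two at the ends of [d]. These differ because [d] is a bridge, so dropping the one at [u]
    leaves a bijection. *)
Lemma card_components_forestD1 F W d k : forest F -> F d -> ends d `<=` W ->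
  (components W F #= `I_k)%card <-> (components W (F `\ d) #= `I_k.+1)%card.
Proof.
move=> fF Fd dW; have [u [v [_ duv]]] := endsP d.
have {}duv : joins d u v by [].
have Wu : W u by apply: dW; rewrite duv; left.
have Wv : W v by apply: dW; rewrite duv; right.
have uv := fF _ _ _ Fd duv.
have luv : linked F u v by exact: linked_edge duv.
have FF : F `\ d `<=` F by move=> ? [].
pose f (C : set (vertex G)) : set (vertex G) := \bigcup_(x in C) linked F x.
have fE x : f (linked (F `\ d) x) = linked F x.
  apply/seteqP; split=> [y [z xz zy]|y xy].
    by apply: linked_trans zy; exact: linkedS xz.
  by exists x => //; exact: linked_refl.
rewrite -(card_setD1 _ (x := linked (F `\ d) u)); last by exists u.
have <- : f @` (components W (F `\ d) `\ linked (F `\ d) u) = components W F.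
  apply/seteqP; split=> [_ [_ [[x Wx <-] _] <-]|_ [x Wx <-]].
    by rewrite fE; exists x.
  have [xu|xu] := pselect (linked (F `\ d) x u).
    exists (linked (F `\ d) v); last first.
      by rewrite fE -(linked_eq luv); apply/esym/linked_eq; exact: linkedS xu.
    split; first by exists v.
    by move=> /= vu; apply: uv; rewrite -vu; exact: linked_refl.
  exists (linked (F `\ d) x) => //; split; first by exists x.
  by move=> /= E; apply: xu; rewrite E; exact: linked_refl.
rewrite (card_eql (inj_card_eq _)) // => C D /set_mem[[x Wx <-] xu] /set_mem[[y Wy <-] yu].
rewrite !fE => E; apply: linked_eq.
have : linked (F `\ d `|` [set d]) x y.
  by rewrite setUC setD1K// E; exact: linked_refl.
move=> /(linked_setU1 duv) [//|[xu' _]|[_ uy]].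
- by case: xu; exact: linked_eq xu'.
- by case: yu; apply: linked_eq; exact: linked_sym.
Qed.

Lemma card_components_forestD F W D k n : forest F ->
  (forall e, F e -> ends e `<=` W) -> D `<=` F -> (D #= `I_n)%card ->
  (components W F #= `I_k)%card -> (components W (F `\` D) #= `I_(k + n))%card.
Proof.
elim: n F D k => [|n IH] F D k fF FW DF Dn Fk.
  by move: Dn; rewrite II0 card_eq0 => /eqP ->; rewrite setD0 addn0.
have [d Dd Ddn] := @eq_cardSP _ _ _ Dn.
have Fd := DF _ Dd.
have -> : F `\` D = (F `\ d) `\` (D `\ d) by rewrite setDDl setD1K.
rewrite addnS -addSn; apply: IH => //.
- by apply: forestS fF => ? [].
- by move=> e [/FW].
- by move=> e [/DF].
- exact/(card_components_forestD1 _ fF Fd (FW _ Fd)).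
Qed.

(** Finiteness of [D] is a conclusion here: the induction is on the number of components left, and
    putting an edge of [D] back lowers it by one. *)
Lemma card_components_forestD_inv F W D m : forest F ->
  (forall e, F e -> ends e `<=` W) -> D `<=` F ->
  (components W (F `\` D) #= `I_m)%card ->
  exists k n, [/\ (components W F #= `I_k)%card, (D #= `I_n)%card & m = (k + n)%N].
Proof.
move=> fF FW; elim: m D => [|m IH] D DF Fm.
  (* No components means no vertices, hence no edges in [F] and none in [D]. *)
  have W0 : W = set0.
    rewrite -subset0 => x Wx; move: Fm; rewrite II0 card_eq0 => /eqP /seteqP[+ _].
    by move=> /(_ (linked (F `\` D) x)); apply; exists x.
  exists 0%N, 0%N; split=> //.
    by rewrite /components W0 image_set0 II0.
  rewrite II0 card_eq0; apply/eqP; rewrite -subset0 => d /DF/FW.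
  have [u [v [_ ->]]] := endsP d.
  by rewrite W0 => /(_ u); apply; left.
have [D0|/set0P[d Dd]] := eqVneq D set0.
  exists m.+1, 0%N; split; rewrite ?addn0//; last by rewrite D0 II0.
  by move: Fm; rewrite D0 setD0.
have Fd := DF _ Dd.
have E : F `\` D = (F `\` (D `\ d)) `\ d by rewrite setDDl setUC setD1K.
have [||k [n [Fk Dn ->]]] := IH (D `\ d).
- by move=> e [/DF].
- apply/(card_components_forestD1 (d := d)); rewrite -?E//.
  + by apply: forestS fF => ? [].
  + by split=> // -[_]; exact.
  + exact: FW.
exists k, n.+1; split=> //; last by rewrite addnS.
exact/(card_setD1 _ Dd).
Qed.

End Graph.

(** * Walks, forests and components in the split graph *)

Section SplitGraph.
Set Implicit Arguments.
Unset Strict Implicit.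

Context {G : graph} (X : set (edge G)).
Implicit Types (A B Q T : set (edge G)) (P S U : set (vertex G)).
Implicit Types (u v w x y z : vertex G) (e : edge G) (s t : bool).

Definition side s : set (edge G) := if s then X else ~` X.

Definition side_of e : bool := `[< X e >].

Lemma side_side_of e s : side s e <-> s = side_of e.
Proof.
rewrite /side_of; case: s; case: asboolP => Xe /=; split=> //.
Qed.

Definition split_ends (f : edge G + vertex G) : set (vertex G * bool) :=
  match f with
  | inl e => [set p | ends e p.1 /\ p.2 = side_of e]
  | inr w => [set p | p.1 = w]
  end.

Lemma split_ends_inl e u v : joins e u v ->
  split_ends (inl e) = [set (u, side_of e); (v, side_of e)].
Proof.
move=> /= ->; apply/seteqP; split=> [[x s] /= [+ ->]|[x s]].
  by case=> ->; [left|right].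
by case=> -[-> ->] /=; split=> //; [left|right].
Qed.

Lemma split_ends_inr w : split_ends (inr w) = [set (w, true); (w, false)].
Proof.
apply/seteqP; split=> [[x []] /= ->|[x s] [] [-> ->]] //; by [left|right].
Qed.

Lemma split_endsP f : exists p q, p <> q /\ split_ends f = [set p; q].
Proof.
case: f => [e|w].
  have [u [v [uv euv]]] := endsP e.
  exists (u, side_of e), (v, side_of e); split; first by case.
  exact: split_ends_inl.
by exists (w, true), (w, false); split=> //; exact: split_ends_inr.
Qed.

(* For uniformity every vertex gets two copies and a new edge; only the copies
   in split_vertices and the new edges at U are meaningful. *)
Definition split_graph : graph := Graph split_endsP.

Notation SG := split_graph.
Notation old A := (inl @` A : set (edge SG)).
Notation new S := (inr @` S : set (edge SG)).

Lemma joins_old e u v s t : @joins SG (inl e) (u, s) (v, t) <->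
  [/\ joins e u v, s = side_of e & t = side_of e].
Proof.
split=> [|[euv -> ->]]; last exact: split_ends_inl.
have [x [y [_ exy]]] := endsP e.
have sxy : @joins SG (inl e) (x, side_of e) (y, side_of e).
  exact: split_ends_inl.
move=> /(joins_inj sxy)[[[<- <-] [<- <-]]|[[<- <-] [<- <-]]]; split=> //.
exact: joins_sym.
Qed.

Lemma joins_new w u v s t : @joins SG (inr w) (u, s) (v, t) ->
  [/\ u = w, v = w & s = ~~ t].
Proof.
have ww : @joins SG (inr w) (w, true) (w, false) by exact: split_ends_inr.
by move=> /(joins_inj ww)[[[<- <-] [<- <-]]|[[<- <-] [<- <-]]].
Qed.

Lemma linked_new (A : set (edge SG)) w s t : A (inr w) -> linked A (w, s) (w, t).
Proof.
have ww : @joins SG (inr w) (w, true) (w, false) by exact: split_ends_inr.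
move=> Aw; have l := linked_edge Aw ww.
by case: s t => -[] //; try exact: linked_refl; exact: linked_sym.
Qed.

Lemma linked_old (A : set (edge SG)) e u v s :
  A (inl e) -> joins e u v -> side s e -> linked A (u, s) (v, s).
Proof.
move=> Ae euv /side_side_of se; apply: (linked_edge Ae).
exact/joins_old.
Qed.

(** Forgetting the side contracts every new edge to a vertex and keeps the old ones. *)
Lemma linked_split_proj (A : set (edge SG)) B (p q : vertex SG) :
  (forall e, A (inl e) -> B e) -> linked A p q -> linked B p.1 q.1.
Proof.
move=> AB; elim=> [[x s] [y t] [[e|w] Aw]|[x s]|p' q' r _ IH1 _ IH2].
- by move=> /joins_old[exy _ _]; apply: linked_edge exy; exact: AB.
- by move=> /joins_new[-> -> _]; exact: linked_refl.
- exact: linked_refl.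
- exact: linked_trans IH1 IH2.
Qed.

Lemma linked_oldP A u v s t : linked (old A) (u, s) (v, t) <->
  s = t /\ linked (A `&` side s) u v.
Proof.
split=> [l|[<-]].
  suff: forall p q : vertex SG, linked (old A) p q ->
    p.2 = q.2 /\ linked (A `&` side p.2) p.1 q.1 by move=> /(_ _ _ l).
  move=> {u v s t l} p q.
  elim=> [[x s] [y t] [_ [e Ae <-]]|[x s]|p' q' r _ [E1 l1] _ [E2 l2]].
  - move=> /joins_old[exy -> ->]; split=> //; apply: linked_edge exy.
    by split=> //; exact/side_side_of.
  - by split=> //; exact: linked_refl.
  - by split; [rewrite E1|apply: linked_trans l1 _; rewrite E1].
elim=> [x y [e [Ae se] exy]|x|x y z _ IH1 _ IH2].
- by apply: linked_old exy se; exists e.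
- exact: linked_refl.
- exact: linked_trans IH1 IH2.
Qed.

Lemma linked_oldE A u s :
  linked (old A) (u, s) = (fun v => (v, s)) @` linked (A `&` side s) u.
Proof.
apply/seteqP; split=> [[v t] /linked_oldP[<- l]|_ [v l <-]]; first by exists v.
exact/linked_oldP.
Qed.

(** Only copies carrying an old edge are kept, so that isolated copies are not counted as
    components. *)
Definition split_vertices : set (vertex SG) :=
  [set p | incident_vertices (side p.2) p.1].

Notation W := split_vertices.
Notation U := (incident_vertices X `&` incident_vertices (~` X)).

Lemma split_vertices_both w s t : W (w, s) -> W (w, t) -> s <> t -> U w.
Proof. by case: s t => -[] // H K _; split. Qed.

Lemma old_split_vertices e (p : vertex SG) : split_ends (inl e) p -> W p.
Proof.
case: p => u s /= [eu se]; exists e => //.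
exact/side_side_of.
Qed.

Lemma new_split_vertices w (p : vertex SG) : U w -> split_ends (inr w) p -> W p.
Proof. by case: p => u [] [? ?] /= ->. Qed.

(** The walk is lifted edge by edge; where consecutive edges lie on different sides, the vertex is
    in [U] and its new edge makes the switch. The set [P] controls which new edges occur: all of
    them, or all but the one at a given vertex. *)
Lemma linked_split Q P u v s t : P u ->
  (forall e, Q e -> ends e `<=` P) -> linked Q u v -> W (u, s) -> W (v, t) ->
  linked (old Q `|` new (U `&` P)) (u, s) (v, t).
Proof.
move=> Pu QP l Wus.
have switch x s' t' : P x -> W (x, s') -> W (x, t') ->
    linked (old Q `|` new (U `&` P)) (x, s') (x, t').
  move=> Px Ws Wt; have [->|/eqP st] := eqVneq s' t'; first exact: linked_refl.
  apply: linked_new; right; exists x => //; split=> //.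
  exact: split_vertices_both Ws Wt st.
move: t; have {l} := clos_rt_rtn1 _ _ _ _ l; elim=> [|y z [e Qe eyz] _ IH] t Wt.
  exact: switch.
have Wy : W (y, side_of e).
  by apply: (@old_split_vertices e); rewrite (split_ends_inl eyz); left.
have Wz : W (z, side_of e).
  by apply: (@old_split_vertices e); rewrite (split_ends_inl eyz); right.
have Pz : P z by apply: (QP _ Qe); rewrite eyz; right.
apply: linked_trans (IH _ Wy) _; apply: linked_trans (switch _ _ _ Pz Wz Wt).
apply: linked_old eyz _; last exact/side_side_of.
by left; exists e.
Qed.

Lemma forest_old A : (forall s, forest (A `&` side s)) -> forest (old A).
Proof.
move=> fA _ [u s] [v t] [e Ae <-] /joins_old[euv /side_side_of se _] l.
apply: (fA s e u v) => //; suff /linked_oldP[_] : linked (old (A `\ e)) (u, s) (v, t).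
  by apply: linkedS => g [[Ag ge] sg].
apply: linkedS l => _ [[g Ag <-] ge]; exists g => //.
by split=> // /= E; apply: ge; rewrite E.
Qed.

Lemma forest_split T S : forest T -> forest (old T `|` new S).
Proof.
move=> fT f [u s] [v t] [[e Te <-]|[w Sw <-]].
  (* For an old edge, a detour around it would project to a detour around [e] in [T]. *)
  move=> /joins_old[euv _ _] l.
  apply: (fT _ _ _ Te euv); apply: linked_split_proj l => g [[[h Th [<-]]|[]//] ge].
  by split=> // /= E; apply: ge; rewrite E.
move=> /joins_new[-> -> st] l; rewrite {u v}.
(* A walk leaving (w, s) without using the edge inr w stays, once projected to
   the forest T, in the branches at w whose first edge is on side s. *)
pose I (p : vertex SG) := p = (w, s) \/
  exists e y, [/\ T e, side s e, joins e w y & linked (T `\ e) y p.1].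
(* The other copy of [w] cannot satisfy [I]: a branch returning to [w] without its first edge [e]
   would contradict that [e] is a bridge of [T]. *)
suff : I (w, t).
  case=> [[ts]|[e [y [Te _ ewy l']]]]; first by move: st; rewrite ts; case: (s).
  by apply: (fT _ _ _ Te ewy); exact: linked_sym.
have {l} := clos_rt_rtn1 _ _ _ _ l; elim=> [|p q [g [Ag gw] gpq] _ IH].
  by left.
case: Ag gw gpq => [[e Te <-]|[z Sz <-]] gw; last first.
  case: p q IH => [x s'] [y t'] IH /joins_new[xz yz _].
  move: IH; rewrite xz yz => -[[zw]|[e [y' ?]]].
    by case: gw; rewrite zw.
  by right; exists e, y'.
case: p q IH => [x s'] [y t'] IH /joins_old[exy s'e ->].
move: IH; rewrite s'e => -[[xw ss]|].
  right; exists e, y; split=> //.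
  - exact/side_side_of.
  - by rewrite -xw.
  - exact: linked_refl.
move=> [e' [y' [Te' se' ewy' l]]] /=.
have [ee|ee] := pselect (e' = e); last first.
  right; exists e', y'; split=> //; apply: linked_trans l _.
  by apply: linked_edge exy; split=> // /= E; apply: ee.
(* Crossing the first edge of the branch can only lead back to [(w, s)], since the branch does not
   reach [w] otherwise. *)
rewrite -ee in exy *; have [[wx _]|[wy _]] := joins_inj ewy' exy.
  by case: (fT _ _ _ Te' ewy'); apply: linked_sym; rewrite wx.
by left; rewrite -wy; congr pair; apply/esym/side_side_of.
Qed.

(** Old edges never change side, so the components are tagged copies of those of [X] and of its
    complement. The tags keep the two families disjoint. *)
Lemma card_components_old A k :
  (forall s u v, linked (A `&` side s) u v <-> linked (side s) u v) ->
  (components W (old A) #= `I_k)%card ->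
  exists a b, [/\ (components (incident_vertices X) X #= `I_a)%card,
    (components (incident_vertices (~` X)) (~` X) #= `I_b)%card & k = (a + b)%N].
Proof.
move=> As Wk.
pose copy s (C : set (vertex G)) : set (vertex SG) := (fun v => (v, s)) @` C.
pose comps s := components (incident_vertices (side s)) (side s).
have copy_inj s : {in comps s &, injective (copy s)}.
  move=> C D _ _ /seteqP[CD DC]; apply/seteqP; split=> x xC.
    by have [|y Dy [<-]] := CD (x, s); first by exists x.
  by have [|y Dy [<-]] := DC (x, s); first by exists x.
have linkedE s u : linked (old A) (u, s) = copy s (linked (side s) u).
  by rewrite linked_oldE; congr image; apply/seteqP; split=> v /As.
have WE : components W (old A) = copy true @` comps true `|` copy false @` comps false.
  apply/seteqP; split=> [_ [[u s] Wu <-]|C].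
    rewrite linkedE; case: s Wu => Wu; [left|right];
      by eexists; [exists u|].
  by case=> [[_ [u Wu <-] <-]|[_ [u Wu <-] <-]]; rewrite -linkedE;
    [exists (u, true)|exists (u, false)].
have [finX finY] : finite_set (copy true @` comps true) /\
    finite_set (copy false @` comps false).
  by rewrite -finite_setU -WE; exists k.
case: (finX) (finY) => a Xa [b Yb]; exists a, b.
split.
- by rewrite -(card_eql (inj_card_eq (copy_inj true))).
- by rewrite -(card_eql (inj_card_eq (copy_inj false))).
apply/card_eq_II; rewrite -(card_eql Wk) WE.
apply: card_disjoint_setU => //; rewrite -subset0 => C [[_ [u _ <-] <-] [_ [v _ <-]]].
move=> /seteqP[/(_ (v, false)) + _].
by case=> [|? _ []//]; exists v => //; exact: linked_refl.
Qed.

End SplitGraph.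

(** * Consequences of 2-connectedness *)

Section TwoConnected.
Set Implicit Arguments.
Unset Strict Implicit.

Context {G : graph} (G2 : k_connected 2 G).

Lemma two_connected_linked (u v : vertex G) : linked setT u v.
Proof.
have [|_ con] := G2.2 set0.
  by have -> : ecard (@set0 (vertex G)) = 0%:E by apply/(ecard_fin _ 0); rewrite II0.
by apply: linkedS (con u v _ _).
Qed.

Lemma two_connected_linkedD1 (w u v : vertex G) : u <> w -> v <> w ->
  linked [set e : edge G | ends e `<=` ~` [set w]] u v.
Proof.
have [|_ con] := G2.2 [set w]; last exact: con.
by have -> : ecard [set w] = 1%:E by apply/(ecard_fin _ 1); exact: card_set1.
Qed.

(** Without edges, connectedness would leave a single vertex. The edge is needed to see that the
    split tree has one component rather than none. *)
Lemma two_connected_edge : inhabited (edge G).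
Proof.
apply: contrapT => noe.
have [|[u _] con] := G2.2 set0.
  by have -> : ecard (@set0 (vertex G)) = 0%:E by apply/(ecard_fin _ 0); rewrite II0.
have : ecard [set: vertex G] = 1%:E.
  apply/(ecard_fin _ 1); suff -> : setT = [set u] by exact: card_set1.
  apply/seteqP; split=> // v _ /=.
  elim: (two_connected_linked v u) => // [x y [e]|x y z _ -> _ -> //].
  by case: noe; exact: inhabits e.
by move=> E; have := G2.1; rewrite E.
Qed.

End TwoConnected.

(** * Counting and finiteness for a fixed choice of bases *)

Section Connectivity.
Set Implicit Arguments.
Unset Strict Implicit.

Context {G : graph} (X B B' A : set (edge G)).
Context (G2 : k_connected 2 G).
Context (BX : restr_basis (finite_cycle_matroid G) X B).
Context (B'X : restr_basis (finite_cycle_matroid G) (~` X) B').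
Context (AB : A `<=` B `|` B').
Context (TG : basis (finite_cycle_matroid G) ((B `|` B') `\` A)).

Let T := (B `|` B') `\` A.
Let U := incident_vertices X `&` incident_vertices (~` X).
Notation SG := (split_graph X).
Notation old A := (inl @` A : set (edge SG)).
Notation new S := (inr @` S : set (edge SG)).
Notation W := (@split_vertices G X).

Let basis_side s : (B `|` B') `&` side X s = if s then B else B'.
Proof.
case: BX B'X => -[_ sB] _ [[_ sB'] _].
case: s; rewrite setIUl /=.
  have -> : B' `&` X = set0 by rewrite -subset0 => e [/sB' ? ?].
  by rewrite setU0; apply/setIidPl.
have -> : B `&` ~` X = set0 by rewrite -subset0 => e [/sB ? ?].
by rewrite set0U; apply/setIidPl.
Qed.

Let linked_basis_side s u v :
  linked ((B `|` B') `&` side X s) u v <-> linked (side X s) u v.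
Proof.
rewrite basis_side; case: s; exact: linked_maximal_acyclic.
Qed.

Let forest_bases : forest (old (B `|` B')).
Proof.
apply: forest_old => s; rewrite basis_side; apply: acyclic_forest.
by case: BX B'X => -[? _] _ [[? _] _]; case: s.
Qed.

Let forest_tree S : forest (old T `|` new S).
Proof. by apply: forest_split; apply: acyclic_forest; case: TG. Qed.

Let linked_tree u v : linked T u v.
Proof.
have TM : maximal_in [set J | acyclic J /\ J `<=` setT] T.
  by case: TG => aT Tmax; split=> // J [aJ _]; exact: Tmax.
by have [_] := linked_maximal_acyclic u v TM; apply; exact: two_connected_linked.
Qed.

Let linked_split_tree p q : W p -> W q ->
  linked (old T `|` new U) p q.
Proof.
case: p q => [u s] [v t] Wp Wq; rewrite -[U]setIT.
exact: (linked_split _ _ (linked_tree u v) Wp Wq).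
Qed.

Let oldD : old (B `|` B') `\` old A = old T.
Proof.
apply/seteqP; split=> [_ [[e Be <-] nAe]|_ [e [Be nAe] <-]].
  by exists e => //; split=> // Ae; apply: nAe; exists e.
by split; [exists e|case=> g Ag [gE]; rewrite gE in Ag].
Qed.

Let treeD : (old T `|` new U) `\` new U = old T.
Proof.
rewrite setDUl setDv setU0; apply/seteqP; split=> [e []//|_ [e Te <-]].
by split; [exists e|case].
Qed.

(** The components of [old T] are counted twice: by deleting the new edges from the split tree, and
    by deleting [old A] from the two bases. *)
Lemma card_attachments n : (U #= `I_n)%card ->
  exists k a b, [/\ (A #= `I_k)%card,
    (components (incident_vertices X) X #= `I_a)%card,
    (components (incident_vertices (~` X)) (~` X) #= `I_b)%card &
    (n.+1 = a + b + k)%N].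
Proof.
move=> Un.
have tree1 : (components W (old T `|` new U) #= `I_1)%card.
  have [e] := two_connected_edge G2.
  have [u [v [_ euv]]] := endsP e.
  have Wu : W (u, side_of X e).
    by apply: (@old_split_vertices _ _ e); rewrite /= euv; split=> //; left.
  suff -> : components W (old T `|` new U) =
    [set linked (old T `|` new U) (u, side_of X e)] by exact: card_set1.
  apply/seteqP; split=> [_ [p Wp <-]|_ ->]; last by exists (u, side_of X e).
  by apply: linked_eq; exact: linked_split_tree.
have cT : (components W (old T) #= `I_(1 + n))%card.
  rewrite -treeD; apply: card_components_forestD => //.
  - move=> f [[e _ <-]|[w Uw <-]] p.
      exact: old_split_vertices.
    exact: new_split_vertices.
  - by rewrite (card_eql (inj_card_eq _))// => x y _ _ [].
have oldA : (old A #= A)%card by apply: inj_card_eq => x y _ _ [].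
rewrite -oldD in cT.
(* Only the count after deletion is known; finiteness of [A] and of the component number of the
   bases comes out of it. *)
have [||c [k [Bc]]] := card_components_forestD_inv forest_bases _ _ cT.
- by move=> _ [e _ <-] p; exact: old_split_vertices.
- exact: image_subset.
rewrite (card_eql oldA) add1n => Ak ->.
have [a [b [Xa Yb ->]]] := card_components_old linked_basis_side Bc.
by exists k, a, b.
Qed.

Lemma finite_attachments : finite_set A -> finite_set U.
Proof.
move=> finA.
(* [F] contains the edges of a path in the split tree between the ends of [f]; for [f] outside
   [old A] the value [set0] is a dummy. *)
have fundamental (f : edge SG) : exists F, old A f -> [/\ finite_set F,
    F `<=` old T `|` new U & forall p q, joins f p q -> linked F p q].
  have [p [q [_ fpq]]] := endsP f.
  have [[e Ae fe]|nAf] := pselect (old A f); last by exists set0.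
  have Wf r : ends f r -> W r by rewrite -fe; exact: old_split_vertices.
  have : linked (old T `|` new U) p q.
    by apply: linked_split_tree; apply: Wf; rewrite fpq; [left|right].
  move=> /linked_finite[F [finF FT lF]].
  exists F => _; split=> // p' q' /(joins_inj fpq)[[<- <-//]|[<- <-]].
  exact: linked_sym.
have [F FP] := choice fundamental.
have finF : finite_set (\bigcup_(f in old A) F f).
  apply: bigcup_finite; first exact: finite_image.
  by move=> f /FP[].
suff UF : new U `<=` \bigcup_(f in old A) F f.
  have := sub_finite_set UF finF.
  have newU : (new U #= U)%card by apply: inj_card_eq => x y _ _ [].
  by move=> [n Un]; exists n; rewrite -(card_eql newU).
move=> _ [w Uw <-]; apply: contrapT => nF.
(* If none of these paths uses the new edge at [w], then the tree without that edge still links the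
   ends of every basis edge, hence of every old edge. *)
pose T' := (old T `|` new U) `\ inr w.
have edgeT' f p q : old (B `|` B') f -> joins f p q -> linked T' p q.
  move=> [e Be <-] fpq.
  have [Ae|nAe] := pselect (A e).
    have [|_ FT /(_ _ _ fpq)] := FP (inl e); first by exists e.
    apply: linkedS => g Fg; split; first exact: FT.
    by move=> /= gw; apply: nF; exists (inl e); [exists e|rewrite -gw].
  apply: linked_edge fpq; split=> //.
  by left; exists e.
have all_edgeT' f p q : (old setT `|` new (U `&` ~` [set w])) f -> joins f p q ->
    linked T' p q.
  move=> [[e _ <-]|[v [Uv vw] <-]] fpq; last first.
    apply: linked_edge fpq; split; first by right; exists v.
    by move=> [/vw].
  case: p q fpq => [u s] [v t] /joins_old[euv ss ts]; rewrite ts -ss.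
  have /linked_basis_side luv : linked (side X s) u v.
    by apply: linked_edge euv; apply/side_side_of.
  have : linked (old (B `|` B')) (u, s) (v, s) by exact/linked_oldP.
  exact: linked_of_edges.
have linkT' := linked_of_edges all_edgeT'.
(* As [w] is in [U], it has a neighbour on each side, from which a walk in [G] minus [w] can start
   or end. *)
have nbr s : exists v, [/\ v <> w, W (v, s) & linked T' (w, s) (v, s)].
  have [e se we] : incident_vertices (side X s) w by case: Uw; case: s.
  have [u [v [uv euv]]] := endsP e.
  have {u v uv euv we} [v ewv] : exists v, joins e w v.
    move: we; rewrite euv => -[->|->]; [by exists v|exists u].
    exact: joins_sym.
  exists v; split.
  - by move=> vw; apply: (joins_neq ewv); rewrite vw.
  - by exists e => //; rewrite ewv; right.
  - apply: linkT'; apply: linked_old ewv se.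
    by left; exists e.
have [x [xw Wx wx]] := nbr true; have [y [yw Wy wy]] := nbr false.
(* The route from [(w, true)] over [x] and [y] to [(w, false)] bypasses [inr w], which is a bridge
   of the split tree. *)
apply: (@forest_tree U (inr w) (w, true) (w, false)).
- by right; exists w.
- exact: split_ends_inr.
apply: linked_trans wx _; apply: linked_trans (linked_sym wy).
apply: linkT'; have := @linked_split _ X _ (~` [set w]) x y true false xw _
  (two_connected_linkedD1 G2 xw yw) Wx Wy.
by move=> H; apply: linkedS (H _) => // f [[e _ <-]|]; [left; exists e|right].
Qed.

End Connectivity.

Theorem theorem3 (G : graph) (X : set (edge G))
    (Y := ~` X)
    (U := incident_vertices X `&` incident_vertices Y)
    (kappa := connectivity (finite_cycle_matroid G) X) :
  k_connected 2 G -> finitely_separable G ->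
  (kappa = +oo <-> ecard U = +oo) /\
  (kappa < +oo -> kappa = ecard U - ncomp X - ncomp Y + 1).
Proof.
move=> G2 _; rewrite {}/kappa /connectivity.
(* The chosen value comes with some bases and some [A]; the two lemmas above apply to any of
   them. *)
case: cid => _ /= [B [B' [A [BX B'X AB TG ->]]]].
have finU := card_attachments G2 BX B'X AB TG.
have finA := finite_attachments G2 BX B'X TG.
split.
  rewrite !ecard_pinfty; split=> [infA [n /finU[k [_ [_ [Ak _ _ _]]]]]|infU /finA//].
  by apply: infA; exists k.
have [/finA[n Un] _|/ecard_pinfty->//] := pselect (finite_set A).
have [k [a [b [Ak Xa Yb nabk]]]] := finU n Un.
move/ecard_fin: Un => ->; move/ecard_fin: Ak => ->.
rewrite /ncomp; move/ecard_fin: Xa => ->; move/ecard_fin: Yb => ->.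
(* All terms are finite by now, so the identity is one of integers, a rearrangement of [nabk]. *)
rewrite -!EFinB -EFinD; congr EFin.
lia.
Qed.
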